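(* Let $\kappa$ be an algebraically closed field with $\operatorname{char}(\kappa)\neq 2$. Then $1$-accessibility is not transitive in the symplectic algebras: there exist $n\geq 1$ and nilpotent orbits $\mathcal{O}_1,\mathcal{O}_2,\mathcal{O}_3$ of $\mathrm{Sp}_{2n}(\kappa)$ in $\mathfrak{sp}_{2n}(\kappa)$ such that $\mathcal{O}_2$ is $1$-accessible from $\mathcal{O}_1$ and $\mathcal{O}_3$ is $1$-accessible from $\mathcal{O}_2$, but $\mathcal{O}_3$ is not $1$-accessible from $\mathcal{O}_1$.
   Context: $G=\mathrm{Sp}_{2n}(\kappa)$ is the group of $g\in\mathrm{GL}_{2n}(\kappa)$ with $g^\top\Omega_S g=\Omega_S$, where $\Omega_S$ is the matrix with columns $(-e_{2n},\ldots,-e_{n+1},e_n,\ldots,e_1)$; $\mathfrak{sp}_{2n}(\kappa)$ consists of the matrices $x$ with $x^\top\Omega_S+\Omega_S x=0$. The nilpotent orbits are the $G$-conjugation orbits of nilpotent elements of $\mathfrak{sp}_{2n}(\kappa)$. They are labelled by the partitions of $2n$ (Jordan block sizes) in which every odd part has even multiplicity. A cocharacter of $G$ is a homomorphism of algebraic groups $\lambda:\mathbb{G}_m\to G$. The limit $\lim_\lambda x=\lim_{a\to0}\lambda(a)\cdot x$ exists if $a\mapsto\lambda(a)\cdot x$ extends to a morphism from $\mathbb{A}^1$; the limit is the image of $0$. An orbit $\mathcal{O}(y)$ is $1$-accessible from $\mathcal{O}(x)$ if there are a cocharacter $\lambda$ of $G$ and an element $x'\in\mathcal{O}(x)$ such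 that $\lim_\lambda x'$ exists and lies in $\mathcal{O}(y)$ (by conjugating $\lambda$ one may equivalently take $x'=x$). *)

(* Defs.v *)
From HB Require Import structures.
From mathcomp Require Import all_boot all_order all_algebra.
Set Implicit Arguments.
Unset Strict Implicit.
Unset Printing Implicit Defensive.
Import GRing.Theory.
Local Open Scope ring_scope.

(* Columns are numbered from 0: column j is - e_(2n-1-j) for j < n and       *)
(* e_(2n-1-j) for n <= j, where rev_ord j has value 2n-1-j.                  *)
Definition OmegaS (K : closedFieldType) (n : nat) : 'M[K]_(2 * n) :=
  \matrix_(i, j) (if i == rev_ord j then (if (j < n)%N then -1 else 1) else 0).

Definition Sp (K : closedFieldType) (n : nat) : {pred 'M[K]_(2 * n)} :=
  [pred g | (g \in unitmx) && (g^T *m OmegaS K n *m g == OmegaS K n)].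
Arguments Sp : clear implicits.

Definition sp (K : closedFieldType) (n : nat) : {pred 'M[K]_(2 * n)} :=
  [pred x | x^T *m OmegaS K n + OmegaS K n *m x == 0].
Arguments sp : clear implicits.

Definition nilpotent_mx (K : closedFieldType) (n : nat) (x : 'M[K]_n) : Prop :=
  exists k : nat, x ^+ k = 0.

Definition Ad (K : closedFieldType) (n : nat) (g x : 'M[K]_n) : 'M[K]_n :=
  g *m x *m invmx g.

Definition Sp_orbit (K : closedFieldType) (n : nat) (x : 'M[K]_(2 * n)) :
    'M[K]_(2 * n) -> Prop :=
  fun y => exists2 g, g \in Sp K n & y = Ad g x.

Definition nilpotent_orbit (K : closedFieldType) (n : nat)
    (O : 'M[K]_(2 * n) -> Prop) : Prop :=
  exists x, [/\ x \in sp K n, nilpotent_mx x & O = Sp_orbit x].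

(* G_m is the set of nonzero elements of K, with coordinate ring K[t, t^-1]; *)
(* functions on G_m are represented by functions on K whose value at 0 is    *)
(* irrelevant.                                                               *)
Definition regular_Gm (K : closedFieldType) (f : K -> K) : Prop :=
  exists (p : {poly K}) (m : nat), forall a, a != 0 -> f a = p.[a] / a ^+ m.

Definition regular_A1 (K : closedFieldType) (f : K -> K) : Prop :=
  exists p : {poly K}, forall a, f a = p.[a].

(* A map from G_m to the closed subgroup Sp_2n of GL_2n is a morphism of     *)
(* varieties as soon as its entries are regular: the remaining coordinate    *)
(* 1 / det of GL_2n is then regular on G_m too, since det is a nowhere       *)
(* vanishing element of K[t, t^-1], hence a unit.                            *)
Definition cocharacter (K : closedFieldType) (n : nat)
    (lam : K -> 'M[K]_(2 * n)) : Prop :=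
  [/\ forall a, a != 0 -> lam a \in Sp K n,
      forall a b, a != 0 -> b != 0 -> lam (a * b) = lam a *m lam b
    & forall i j, regular_Gm (fun a => lam a i j)].

(* The extension phi takes its values in sp_2n when x is in sp_2n, because   *)
(* sp_2n is closed; its value at 0 is unique because K is infinite.          *)
Definition is_limit (K : closedFieldType) (n : nat)
    (lam : K -> 'M[K]_(2 * n)) (x y : 'M[K]_(2 * n)) : Prop :=
  exists phi : K -> 'M[K]_(2 * n),
    [/\ forall i j, regular_A1 (fun a => phi a i j),
        forall a, a != 0 -> phi a = Ad (lam a) x
      & phi 0 = y].

(* O' is 1-accessible from O. *)
Definition one_accessible (K : closedFieldType) (n : nat)
    (O O' : 'M[K]_(2 * n) -> Prop) : Prop :=
  exists (lam : K -> 'M[K]_(2 * n)) (x y : 'M[K]_(2 * n)),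
    [/\ cocharacter lam, O x, is_limit lam x y & O' y].

(* Main.v *)
(* In sp_8, orbits of type (8), (4,4) and (4,2,1,1) do the job.                *)
(* A limit of x is the graded piece of degree 0 of x for the weight grading of *)
(* the cocharacter. Splitting V into two isotropic halves turns (8) into       *)
(* (4,4); as (4,4) is also an orthogonal sum of two blocks of size 4, one of   *)
(* them can be degenerated to (2,1,1) alone.                                   *)
(* Conversely let y be a limit of x of type (8). The form pairs the weights k  *)
(* and -k, so rank y^j has the parity of the rank of y^j on the weight space   *)
(* V_0, which is a subquotient of V as a module under x; hence y has corank at *)
(* most 1 on V_0. If rank y is even, then, dim V_0 being even, y is bijective  *)
(* on V_0, so V_0 = 0 by nilpotency and every rank y^j is even. For type       *)
(* (4,2,1,1), however, rank y = 4 and rank y^3 = 1.                            *)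
Require Import Defs.
From HB Require Import structures.
From mathcomp Require Import all_boot all_order all_algebra.
From mathcomp Require Import zify ring.
Set Implicit Arguments.
Unset Strict Implicit.
Unset Printing Implicit Defensive.
Import GRing.Theory.
Local Open Scope ring_scope.

(** The obstruction is a parity. A cocharacter splits V into weight spaces ([cocharacter_weights]);
    if the limit y of x exists, x never lowers weights and y is its block-diagonal part
    ([limit_weights]). Opposite weights are dual, so modulo 2 only V_0 contributes to the rank of
    y^j. If x has corank at most 1, so has the map it induces on the subquotient V_0, and
    [odd_rank_limit] follows: when rank y is even, every rank y^j is even. Type (4,2,1,1), with
    ranks 4 and 1 for y and y^3, is thus no limit of type (8), while cocharacters of weights 0, 1,
    -1 reach it in two steps ([limit_nil8_nil44], [limit_nil44_nil4211]). *)

(** * Ranks of matrices cut by idempotents *)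

Lemma mxrank_split (F : fieldType) N (M P Q : 'M[F]_N) :
  M = M *m P + Q *m M -> Q *m M *m P = 0 ->
  \rank M = (\rank (M *m P) + \rank (Q *m M))%N.
Proof.
move=> M_split QMP0; apply/eqP; rewrite eqn_leq; apply/andP; split.
  by rewrite {1}M_split mxrank_add.
rewrite -(mxrank_mul_ker M P) leq_add2l mxrankS // sub_capmx submxMl.
exact/sub_kermxP.
Qed.

(** [A], [E], [B] stand for the projections on positive, zero and negative weights, [W] for the
    form, [M] for a power of y and [s] for a sign; the even term is what makes parities depend on
    V_0 alone. *)
Lemma mxrank_dual_projectors (F : fieldType) N (W M A E B : 'M[F]_N) (s : F) :
    W \in unitmx -> s != 0 -> A + E + B = 1%:M ->
    A *m E = 0 -> A *m B = 0 -> B *m A = 0 -> B *m E = 0 ->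
    A *m M = M *m A -> B *m M = M *m B ->
    A^T *m W = W *m B -> M^T *m W = s *: (W *m M) ->
  \rank M = (\rank (M *m E) + (\rank (M *m A)).*2)%N.
Proof.
move=> uW s0 sum1 AE AB BA BE AM BM dual Mskew.
(* W pairs the images of A and B, on which M acts by transposed maps up to s *)
have rkAB : \rank (M *m B) = \rank (M *m A).
  rewrite -[RHS]mxrank_tr -AM trmx_mul -[RHS](mxrankMfree _ (B := W)); last first.
    by rewrite row_free_unit.
  rewrite -mulmxA dual mulmxA Mskew -scalemxAl eqmx_scale // -mulmxA.
  by rewrite [RHS]eqmxMfull // row_full_unit.
have AMAE : A *m (M *m (A + E)) = M *m A.
  rewrite mulmxA AM -mulmxA; congr (M *m _).
  by rewrite -[RHS]mulmx1 -sum1 !mulmxDr AB addr0.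
have MAEE : M *m (A + E) *m E = M *m E.
  have EE : E *m E = E by rewrite -[RHS]mul1mx -sum1 !mulmxDl AE BE add0r addr0.
  by rewrite -mulmxA mulmxDl AE add0r EE.
rewrite (@mxrank_split _ _ M (A + E) B) ?BM; first last.
- by rewrite -mulmxA mulmxDr BA BE addr0 mulmx0.
- by rewrite -mulmxDr sum1 mulmx1.
rewrite (@mxrank_split _ _ (M *m (A + E)) E A) ?AMAE ?MAEE; first last.
- by rewrite -mulmxA AE mulmx0.
- by rewrite -mulmxDr addrC.
by rewrite rkAB -addnn addnA.
Qed.

Lemma exprmx_skew (F : fieldType) N (W M : 'M[F]_N) j :
  M^T *m W = - (W *m M) -> (M ^+ j)^T *m W = (-1) ^+ j *: (W *m M ^+ j).
Proof.
move=> skew; elim: j => [|j IHj].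
  by rewrite !expr0 scale1r trmx1 mul1mx mulmx1.
rewrite [M ^+ j.+1 in LHS]exprS trmx_mul -mulmxA skew mulmxN mulmxA IHj.
by rewrite -scalemxAl -mulmxA !mulmxE -exprSr [(-1) ^+ j.+1]exprS mulN1r scaleNr.
Qed.

(* The image of A + E is stable under x and E x E is the map induced by x on  *)
(* its quotient by the image of A.                                            *)
Lemma mxrank_graded_piece (F : fieldType) N (x A E B : 'M[F]_N) :
    A + E + B = 1%:M -> A *m E = 0 -> E *m A = 0 -> B *m A = 0 -> B *m E = 0 ->
    B *m x *m (A + E) = 0 -> E *m x *m A = 0 -> (N.-1 <= \rank x)%N ->
  (\rank E <= (\rank (E *m x *m E)).+1)%N.
Proof.
move=> sum1 AE EA BA BE BxAE ExA rkx.
have rkAE : \rank (A + E)%R = (\rank E + \rank A)%N.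
  have EE : E *m E = E by rewrite -[RHS]mul1mx -sum1 !mulmxDl AE BE add0r addr0.
  have AA : A *m A = A by rewrite -[RHS]mul1mx -sum1 !mulmxDl EA BA !addr0.
  have AEE : (A + E) *m E = E by rewrite mulmxDl AE add0r EE.
  have AAE : A *m (A + E) = A. by rewrite mulmxDr AE addr0 AA.
  by rewrite (@mxrank_split _ _ (A + E) E A) ?AEE ?AAE ?AE // addrC.
have xAE : x *m (A + E) = A *m (x *m (A + E)) + E *m x *m E.
  rewrite -{1}[x]mul1mx -{1}sum1 !mulmxDl BxAE addr0 -mulmxA; congr (_ + _).
  by rewrite mulmxDr ExA add0r.
(* Sylvester's inequality: as [x] has corank at most 1, multiplying by it costs at most 1 in
   rank. *)
have := mxrank_mul_min x (A + E); rewrite rkAE xAE => le1.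
have le2 := leq_trans le1 (mxrank_add _ _).
have le3 : (\rank (A *m (x *m (A + E))) <= \rank A)%N by exact: mxrankM_maxl.
lia.
Qed.

(** * Regular maps on the punctured line and their values at 0 *)

Lemma poly_eq_punctured (K : closedFieldType) (p q : {poly K}) :
  (forall a, a != 0 -> p.[a] = q.[a]) -> p = q.
Proof.
move=> pq; apply/eqP; rewrite -subr_eq0; apply: contraT => d0.
(* The factor ['X] makes the non-root [a] nonzero. *)
have /closed_nonrootP[a] : 'X * (p - q) != 0 by rewrite mulf_neq0 ?polyX_eq0.
rewrite rootM rootX negb_or => /andP[a0].
by rewrite rootE hornerD hornerN pq // subrr eqxx.
Qed.

Lemma sum_expr_inj (K : closedFieldType) p q N (M M' : 'I_N -> 'M[K]_(p, q)) :
  (forall a, a != 0 -> \sum_(k < N) a ^+ k *: M k = \sum_(k < N) a ^+ k *: M' k) -> M =1 M'.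
Proof.
move=> MM' k; apply/matrixP=> i j.
pose P (L : 'I_N -> 'M[K]_(p, q)) := \sum_(k < N) L k i j *: 'X^k.
have coefP L : (P L)`_k = L k i j.
  rewrite coef_sum (bigD1 k) //= coefZ coefXn eqxx mulr1 big1 ?addr0 // => l lk.
  by rewrite coefZ coefXn eq_sym (inj_eq val_inj) (negPf lk) mulr0.
rewrite -coefP -[RHS]coefP.
suff -> : P M = P M' by []; apply: poly_eq_punctured => a a0.
have /matrixP/(_ i j) := MM' a a0; rewrite !summxE /P !horner_sum.
under eq_bigr do rewrite mxE mulrC.
under [in RHS]eq_bigr do rewrite mxE mulrC.
under [in X in _ -> X = _]eq_bigr do rewrite hornerZ hornerXn.
by under [in X in _ -> _ = X]eq_bigr do rewrite hornerZ hornerXn.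
Qed.

Lemma regular_A1_mxP (K : closedFieldType) p q (phi : K -> 'M[K]_(p, q)) :
  (forall i j, regular_A1 (fun a => phi a i j)) ->
  exists Phi : 'M[{poly K}]_(p, q), forall a, phi a = map_mx (horner_eval a) Phi.
Proof.
move=> /(_ _)/fin_all_exists reg.
have [Phi phiE] := fin_all_exists reg.
exists (\matrix_(i, j) Phi i j) => a; apply/matrixP=> i j.
by rewrite !mxE phiE.
Qed.

Lemma map_mx_horner_polyC (K : closedFieldType) p q (M : 'M[K]_(p, q)) a :
  map_mx (horner_eval a) (map_mx polyC M) = M.
Proof. by apply/matrixP=> i j; rewrite !mxE /horner_eval hornerC. Qed.

(** A polynomial identity on the punctured line persists at 0. Since [0 ^+ 0] is 1, [c = 0] computes
    a block of the limit, while [d = 0 < c] forces [M = 0]: otherwise the block would have a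
    pole. *)
Lemma regular_A1_block (K : closedFieldType) N (phi : K -> 'M[K]_N)
    (E F M : 'M[K]_N) c d :
  (forall i j, regular_A1 (fun a => phi a i j)) ->
  (forall a, a != 0 -> a ^+ c *: (E *m phi a *m F) = a ^+ d *: M) ->
  0 ^+ c *: (E *m phi 0 *m F) = 0 ^+ d *: M.
Proof.
move=> /regular_A1_mxP[Phi phiE] EphiF.
pose P := map_mx polyC E *m Phi *m map_mx polyC F.
have PE a : E *m phi a *m F = map_mx (horner_eval a) P.
  by rewrite !map_mxM !map_mx_horner_polyC phiE.
have PM : 'X^c *: P = 'X^d *: map_mx polyC M.
  apply/matrixP=> i j; apply: poly_eq_punctured => a a0.
  have /matrixP/(_ i j) := EphiF a a0; rewrite PE.
  by rewrite !mxE !hornerM !hornerXn hornerC.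
have := congr1 (map_mx (horner_eval 0)) PM.
by rewrite PE !map_mxZ map_mx_horner_polyC /= !horner_evalE !hornerXn.
Qed.

(** Bounding pole orders and numerator sizes by the same [m] puts all exponents in the symmetric
    window from -m to m, where [rev_ord] negates weights. *)
Lemma regular_Gm_mxP (K : closedFieldType) p q (lam : K -> 'M[K]_(p, q)) :
  (forall i j, regular_Gm (fun a => lam a i j)) ->
  exists m (L : 'I_m.*2.+1 -> 'M[K]_(p, q)),
    forall a, a != 0 -> a ^+ m *: lam a = \sum_(k < m.*2.+1) a ^+ k *: L k.
Proof.
move=> /(_ _)/fin_all_exists reg.
have [P] := fin_all_exists reg.
move=> {reg} /(_ _)/fin_all_exists reg.
have [d lamE] := fin_all_exists reg.
pose m := \max_i \max_j maxn (size (P i j)) (d i j).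
have szm i j : (size (P i j) <= m)%N.
  exact: leq_trans (leq_trans (leq_maxl _ _) (leq_bigmax j)) (leq_bigmax i).
have dm i j : (d i j <= m)%N.
  exact: leq_trans (leq_trans (leq_maxr _ _) (leq_bigmax j)) (leq_bigmax i).
pose Q i j := P i j * 'X^(m - d i j).
have szQ i j : (size (Q i j) <= m.*2.+1)%N.
  rewrite (leq_trans (size_polyMleq _ _)) // size_polyXn.
  by move: (szm i j) (dm i j); lia.
exists m, (fun k => \matrix_(i, j) (Q i j)`_k) => a a0.
apply/matrixP=> i j; rewrite mxE summxE lamE //.
under eq_bigr do rewrite !mxE mulrC.
rewrite -(horner_coef_wide a (szQ i j)) hornerM hornerXn mulrCA; congr (_ * _).
by rewrite -expfB_cond // (negPf a0) /= ?add0n.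
Qed.

(** * Weight decompositions of cocharacters and limits *)

Lemma Omega_unit (K : closedFieldType) n : OmegaS K n \in unitmx.
Proof.
have OO : OmegaS K n *m (OmegaS K n)^T = 1%:M.
  apply/matrixP=> i j; rewrite !mxE (bigD1 (rev_ord i)) //= big1 => [|k ki].
    rewrite !mxE rev_ordK eqxx addr0 [j == i]eq_sym.
    by case: (i == j); case: ifP; rewrite ?mulr0 ?mulr1 ?mulrNN ?mulr1.
  rewrite !mxE -(inj_eq (can_inj rev_ordK)) rev_ordK [_ == k]eq_sym (negPf ki).
  by rewrite mul0r.
by have [] := mulmx1_unit OO.
Qed.

Lemma Sp_unit (K : closedFieldType) n g : g \in Sp K n -> g \in unitmx.
Proof. by rewrite !inE => /andP[]. Qed.

Lemma Sp_form (K : closedFieldType) n g :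
  g \in Sp K n -> g^T *m OmegaS K n *m g = OmegaS K n.
Proof. by rewrite !inE => /andP[_ /eqP]. Qed.

Lemma mulmx_sum_pair (F : fieldType) N p (P Q : 'I_p -> 'M[F]_N) (c d : 'I_p -> F) :
  (\sum_k c k *: P k) *m (\sum_l d l *: Q l) =
  \sum_k c k *: (\sum_l d l *: (P k *m Q l)).
Proof.
rewrite mulmx_suml; apply: eq_bigr => k _; rewrite -scalemxAl mulmx_sumr.
by congr (_ *: _); apply: eq_bigr => l _; rewrite -scalemxAr.
Qed.

(* The index k in 'I_m.*2.+1 stands for the weight k - m. *)
Lemma cocharacter_weights (K : closedFieldType) n (lam : K -> 'M[K]_(2 * n)) :
  cocharacter lam ->
  exists m (E : 'I_m.*2.+1 -> 'M[K]_(2 * n)),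
    [/\ forall a, a != 0 -> a ^+ m *: lam a = \sum_(k < m.*2.+1) a ^+ k *: E k,
        forall k l, E k *m E l = if k == l then E k else 0,
        \sum_k E k = 1%:M
      & forall k, (E k)^T *m OmegaS K n = OmegaS K n *m E (rev_ord k)].
Proof.
move=> [lamSp lamM /regular_Gm_mxP[m [E lamE]]]; exists m, E.
(* Compare the coefficients of b, then of a, in lam(ab) = lam(a) lam(b). *)
have orthE k l : E k *m E l = if k == l then E k else 0.
  pose D l' := if k == l' then E k else 0.
  rewrite -[RHS]/(D l); move: l; apply: sum_expr_inj => b b0.
  rewrite [RHS](bigD1 k) //= [in RHS]big1 => [|l /negPf kl]; last first.
    by rewrite /D eq_sym kl scaler0.
  rewrite /D eqxx addr0.
  pose L k' := \sum_(l < m.*2.+1) b ^+ l *: (E k' *m E l).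
  rewrite -[LHS]/(L k); move: k {D}; apply: sum_expr_inj => a a0.
  rewrite /L -mulmx_sum_pair -!lamE // -scalemxAl -scalemxAr -lamM // scalerA.
  rewrite -exprMn lamE ?mulf_neq0 //.
  by apply: eq_bigr => k _; rewrite scalerA exprMn.
have lam1 : lam 1 = 1%:M.
  have u1 := Sp_unit (lamSp 1 (oner_neq0 _)).
  by rewrite -(mulmxV u1) -{2}(mulr1 1) lamM ?oner_neq0 // mulmxK.
have sumE : \sum_k E k = 1%:M.
  have := lamE 1 (oner_neq0 _); rewrite lam1 expr1n scale1r => ->.
  by apply: eq_bigr => k _; rewrite expr1n scale1r.
have lamV a : a != 0 -> a ^+ m *: lam a^-1 = \sum_(k < m.*2.+1) a ^+ k *: E (rev_ord k).
  move=> a0; have aV0 : a^-1 != 0 by rewrite invr_eq0.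
  have aaV : a^-1 ^+ m.*2 * a ^+ m = a^-1 ^+ m.
    by rewrite -addnn exprD -mulrA -exprMn mulVf // expr1n mulr1.
  apply: (scalerI (a := a^-1 ^+ m.*2)); first by rewrite expf_neq0.
  rewrite scalerA aaV lamE //.
  rewrite scaler_sumr (reindex_inj rev_ord_inj); apply: eq_bigr => k _ /=.
  rewrite scalerA subSS; congr (_ *: _).
  move: (nat_of_ord k) (leq_ord k) => j jm.
  by rewrite -{2}(subnK jm) exprD -mulrA -exprMn mulVf // expr1n mulr1.
(* Invariance of the form reads lam(a)^T Omega = Omega lam(1/a); its coefficients give the duality
   of opposite weights. *)
split=> //; apply: sum_expr_inj => a a0.
transitivity ((a ^+ m *: lam a)^T *m OmegaS K n).
  rewrite lamE // [X in X *m _]linear_sum mulmx_suml; apply: eq_bigr => k _.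
  by rewrite linearZ /= scalemxAl.
have aV0 : a^-1 != 0 by rewrite invr_eq0.
have lamaV : lam a *m lam a^-1 = 1%:M by rewrite -lamM // mulfV.
transitivity (OmegaS K n *m (a ^+ m *: lam a^-1)).
  rewrite linearZ /= -scalemxAl -scalemxAr; congr (_ *: _).
  by rewrite -[LHS]mulmx1 -lamaV mulmxA Sp_form // lamSp.
by rewrite lamV // mulmx_sumr; apply: eq_bigr => k _; rewrite scalemxAr.
Qed.

(** Conjugation by [lam a] multiplies the block [E k *m x *m E l] by a^(k-l): blocks with negative
    exponent must vanish, those with positive exponent die at 0, the diagonal ones stay. *)
Lemma limit_weights (K : closedFieldType) n (lam : K -> 'M[K]_(2 * n)) x y
    m (E : 'I_m.*2.+1 -> 'M[K]_(2 * n)) :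
  cocharacter lam -> is_limit lam x y ->
  (forall a, a != 0 -> a ^+ m *: lam a = \sum_(k < m.*2.+1) a ^+ k *: E k) ->
  (forall k l, E k *m E l = if k == l then E k else 0) ->
  (forall k l : 'I_m.*2.+1, (k < l)%N -> E k *m x *m E l = 0) /\
  (forall k l, E k *m y *m E l = if k == l then E k *m x *m E k else 0).
Proof.
move=> [lamSp lamM _] [phi [reg phiE <-]] lamE orthE.
have Elam k a : a != 0 -> a ^+ m *: (E k *m lam a) = a ^+ k *: E k.
  move=> a0; rewrite scalemxAr lamE // mulmx_sumr (bigD1 k) //= big1 => [|l lk].
    by rewrite addr0 -scalemxAr orthE eqxx.
  by rewrite -scalemxAr orthE eq_sym (negPf lk) scaler0.
have lamEr k a : a != 0 -> a ^+ m *: (lam a *m E k) = a ^+ k *: E k.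
  move=> a0; rewrite scalemxAl lamE // mulmx_suml (bigD1 k) //= big1 => [|l lk].
    by rewrite addr0 -scalemxAl orthE eqxx.
  by rewrite -scalemxAl orthE (negPf lk) scaler0.
have phiW (k l : 'I_m.*2.+1) a : a != 0 ->
    a ^+ l *: (E k *m phi a *m E l) = a ^+ k *: (E k *m x *m E l).
  move=> a0; rewrite scalemxAr -lamEr // -scalemxAr !scalemxAl -Elam // -!scalemxAl.
  by rewrite phiE // /Ad !mulmxA mulmxKV // Sp_unit // lamSp.
have block (k l : 'I_m.*2.+1) : (l <= k)%N ->
    E k *m phi 0 *m E l = 0 ^+ (k - l) *: (E k *m x *m E l).
  move=> lk; rewrite -[LHS]scale1r -(expr0 0); apply: regular_A1_block => // a a0.
  apply: (scalerI (a := a ^+ l)); first by rewrite expf_neq0.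
  by rewrite scale1r scalerA -exprD subnKC // phiW.
have pole (k l : 'I_m.*2.+1) : (k < l)%N -> E k *m x *m E l = 0.
  move=> kl.
  have := @regular_A1_block K _ phi (E k) (E l) (E k *m x *m E l) (l - k) 0 reg.
  rewrite [0 ^+ 0]expr0 scale1r expr0n subn_eq0 leqNgt kl /= scale0r => -> // a a0.
  apply: (scalerI (a := a ^+ k)); first by rewrite expf_neq0.
  by rewrite scalerA -exprD subnKC ?phiW // ltnW.
split=> // k l; case: eqVneq => [<-|kl].
  by rewrite block // subnn expr0 scale1r.
have [lt_kl|lt_lk|/val_inj/eqP] := ltngtP k l; last by rewrite (negPf kl).
  have := @regular_A1_block K _ phi (E k) (E l) 0 0 0 reg.
  rewrite expr0 !scale1r; apply=> a a0; apply: (scalerI (a := a ^+ l)).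
    by rewrite expf_neq0.
  by rewrite !scale1r phiW // pole // !scaler0.
by rewrite block ?(ltnW lt_lk) // expr0n subn_eq0 leqNgt lt_lk scale0r.
Qed.

(** * The parity obstruction *)

Lemma odd_rank_limit (K : closedFieldType) n (lam : K -> 'M[K]_(2 * n)) x y j :
  cocharacter lam -> is_limit lam x y -> ((2 * n).-1 <= \rank x)%N ->
  y \in sp K n -> nilpotent_mx y -> ~~ odd (\rank y) -> ~~ odd (\rank (y ^+ j)).
Proof.
move=> coch lim rkx /eqP ysp [N yN] ev.
have [m [E [lamE orthE sumE dualE]]] := cocharacter_weights coch.
have [pole block] := limit_weights coch lim lamE orthE.
have o0 k l : k != l -> E k *m E l = 0 by move=> /negPf kl; rewrite orthE kl.
have Ey k : E k *m y = E k *m x *m E k.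
  rewrite -[LHS]mulmx1 -sumE mulmx_sumr (bigD1 k) //= big1 => [|l lk].
    by rewrite addr0 block eqxx.
  by rewrite block eq_sym (negPf lk).
have yE k : y *m E k = E k *m x *m E k.
  rewrite -[LHS]mul1mx -sumE mulmx_suml (bigD1 k) //= big1 => [|l lk].
    by rewrite addr0 mulmxA block eqxx.
  by rewrite mulmxA block (negPf lk).
(* [o] is the index of weight 0; [A] and [B] below project on the positive and negative weights. *)
pose o : 'I_m.*2.+1 := inord m.
have oE : o = m :> nat by rewrite inordK // ltnS -addnn leq_addr.
pose A := \sum_(k < m.*2.+1 | (o < k)%N) E k.
pose B := \sum_(k < m.*2.+1 | (k < o)%N) E k.
have sum1 : A + E o + B = 1%:M.
  rewrite -sumE (bigID (fun k : 'I_m.*2.+1 => (o < k)%N)) /= -/A -addrA; congr (_ + _).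
  rewrite (bigD1 o) ?ltnn //=; congr (_ + _); apply: eq_bigl => k.
  by rewrite -leqNgt andbC -(inj_eq val_inj) -ltn_neqAle.
have sum0 (P Q : pred 'I_m.*2.+1) (M : 'M_(2 * n)) :
    (forall k l, P k -> Q l -> E k *m M *m E l = 0) ->
    (\sum_(k | P k) E k) *m M *m (\sum_(l | Q l) E l) = 0.
  move=> PQ; rewrite !mulmx_suml big1 // => k Pk.
  by rewrite mulmx_sumr big1 // => l Ql; apply: PQ.
have sumo : E o = \sum_(k | k == o) E k by rewrite big_pred1_eq.
have orth0 (P Q : pred 'I_m.*2.+1) : (forall k l, P k -> Q l -> k != l) ->
    (\sum_(k | P k) E k) *m (\sum_(l | Q l) E l) = 0.
  move=> PQ; rewrite -[X in X *m _]mulmx1; apply: sum0 => k l Pk Ql.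
  by rewrite mulmx1 o0 // PQ.
have AE : A *m E o = 0.
  by rewrite sumo; apply: orth0 => k l ok /eqP->; rewrite -(inj_eq val_inj) gtn_eqF.
have EA : E o *m A = 0.
  by rewrite sumo; apply: orth0 => k l /eqP-> ok; rewrite -(inj_eq val_inj) ltn_eqF.
have BE : B *m E o = 0.
  by rewrite sumo; apply: orth0 => k l ok /eqP->; rewrite -(inj_eq val_inj) ltn_eqF.
have BA : B *m A = 0.
  apply: orth0 => k l ko ol; rewrite -(inj_eq val_inj) ltn_eqF //.
  exact: ltn_trans ko ol.
have AB : A *m B = 0.
  apply: orth0 => k l ok lo; rewrite -(inj_eq val_inj) gtn_eqF //.
  exact: ltn_trans lo ok.
have ExA : E o *m x *m A = 0.
  by rewrite sumo; apply: sum0 => k l /eqP-> ol; apply: pole.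
have BxAE : B *m x *m (A + E o) = 0.
  have BxA : B *m x *m A = 0.
    by apply: sum0 => k l ko ol; apply: pole; apply: ltn_trans ko ol.
  rewrite mulmxDr BxA add0r sumo; apply: sum0 => k l ko /eqP->; exact: pole.
have Ay : A *m y = y *m A.
  by rewrite mulmx_suml mulmx_sumr; apply: eq_bigr => k _; rewrite Ey yE.
have By : B *m y = y *m B.
  by rewrite mulmx_suml mulmx_sumr; apply: eq_bigr => k _; rewrite Ey yE.
have powC C i : C *m y = y *m C -> C *m y ^+ i = y ^+ i *m C.
  exact: commrX.
have dual : A^T *m OmegaS K n = OmegaS K n *m B.
  rewrite linear_sum /= mulmx_suml mulmx_sumr (reindex_inj rev_ord_inj).
  apply: eq_big => [k|k _]; last by rewrite dualE rev_ordK.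
  by rewrite oE /= subSS ltn_subRL; lia.
have skew : y^T *m OmegaS K n = - (OmegaS K n *m y).
  by apply/eqP; rewrite -addr_eq0 ysp.
have parity i : odd (\rank (y ^+ i)) = odd (\rank (y ^+ i *m E o)).
  have s0 : (-1) ^+ i != 0 :> K by rewrite expf_neq0 // oppr_eq0 oner_eq0.
  rewrite (mxrank_dual_projectors (Omega_unit K n) s0 sum1) //; last 3 first.
  - exact: powC.
  - exact: powC.
  - exact: exprmx_skew.
  by rewrite oddD odd_double addbF.
(* Parity for y^0: dim V is even, hence so is dim V_0. *)
have rkE : ~~ odd (\rank (E o)).
  by rewrite -[E o]mul1mx -[1%:M]/(y ^+ 0) -parity expr0 mxrank1 mul2n odd_double.
(* Both ranks are even and differ by at most 1, so y is bijective on V_0; nilpotency then leaves V_0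
   = 0. *)
have rkyE : \rank (E o *m y) = \rank (E o).
  have := parity 1%N; rewrite expr1 => par1.
  move: ev; rewrite par1 yE -Ey => ev.
  have := mxrank_graded_piece sum1 AE EA BA BE BxAE ExA rkx; rewrite -Ey => ge.
  have le : (\rank (E o *m y) <= \rank (E o))%N by exact: mxrankM_maxl.
  move: ge le rkE ev; clear; lia.
have EyE : (E o *m y :=: E o)%MS.
  have sub : (E o *m y <= E o)%MS by rewrite Ey -yE submxMl.
  by apply/eqmxP; rewrite -(mxrank_leqif_eq sub) rkyE.
have rkpow i : \rank (E o *m y ^+ i) = \rank (E o).
  elim: i => [|i <-]; first by rewrite expr0 mulmx1.
  by rewrite exprS -mulmxE mulmxA (eqmxMr _ EyE).
have E0 : \rank (E o) = 0%N by rewrite -(rkpow N) yN mulmx0 mxrank0.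
rewrite parity; suff -> : E o = 0 by rewrite mulmx0 mxrank0.
by apply/eqP; rewrite -mxrank_eq0 E0.
Qed.

(** * Invariance under conjugation *)

Lemma Sp1 (K : closedFieldType) n : 1%:M \in Sp K n.
Proof. by rewrite !inE unitmx1 trmx1 mul1mx mulmx1 eqxx. Qed.

Lemma Sp_orbit_refl (K : closedFieldType) n (x : 'M[K]_(2 * n)) : Sp_orbit x x.
Proof.
by exists 1%:M; [exact: Sp1 | rewrite /Ad mul1mx invmx1 mulmx1].
Qed.

Lemma mxrank_Ad (F : closedFieldType) n (g x : 'M[F]_n) :
  g \in unitmx -> \rank (Ad g x) = \rank x.
Proof.
move=> ug; rewrite /Ad mxrankMfree ?row_free_unit ?unitmx_inv //.
by rewrite eqmxMfull // row_full_unit.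
Qed.

Lemma exprmx_Ad (F : closedFieldType) n (g x : 'M[F]_n) j :
  g \in unitmx -> Ad g x ^+ j = Ad g (x ^+ j).
Proof.
move=> ug; elim: j => [|j IHj]; first by rewrite !expr0 /Ad mulmx1 mulmxV.
by rewrite !exprS IHj /Ad -!mulmxE !mulmxA mulmxKV.
Qed.

Lemma Ad_sp (K : closedFieldType) n (g x : 'M[K]_(2 * n)) :
  g \in Sp K n -> x \in sp K n -> Ad g x \in sp K n.
Proof.
move=> gSp; rewrite !inE => /eqP/addr0_eq xsp.
have ug := Sp_unit gSp; have gW := Sp_form gSp.
have gWl : g^T *m OmegaS K n = OmegaS K n *m invmx g by rewrite -{2}gW mulmxK.
have gWr : (invmx g)^T *m OmegaS K n = OmegaS K n *m g.
  by rewrite -{1}gW !mulmxA -trmx_mul mulmxV // trmx1 mul1mx.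
have xsp' : x^T *m OmegaS K n = - (OmegaS K n *m x) by rewrite -xsp opprK.
rewrite /Ad !trmx_mul -!mulmxA gWl [x^T *m _]mulmxA xsp' mulNmx mulmxN.
by rewrite !mulmxA gWr addNr.
Qed.

(** A rank certificate: the factorization through [pid_mx r] bounds the rank above, the product
    [M *m A *m P] below. The scalar [c] lets integer matrices serve over every field where [c] is
    nonzero. *)
Lemma mxrank_pid_factor (F : fieldType) N (A L R M P : 'M[F]_N) (c : F) r :
  (r <= N)%N -> c != 0 ->
  A = L *m pid_mx r *m R -> M *m A *m P = c *: pid_mx r -> \rank A = r.
Proof.
move=> rN c0 Afac Apid; apply/eqP; rewrite eqn_leq; apply/andP; split.
  rewrite Afac (leq_trans (mxrankM_maxl _ _)) // (leq_trans (mxrankM_maxr _ _)) //.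
  by rewrite rank_pid_mx.
rewrite -{1}(@rank_pid_mx F N N r) // -(eqmx_scale (pid_mx r) c0) -Apid.
exact: leq_trans (mxrankM_maxl _ _) (mxrankM_maxr _ _).
Qed.

(** * Cocharacters of weights 0, 1, -1, carried by [E0], [E1], [E2] in this order *)

Definition three_weight (K : closedFieldType) n (E0 E1 E2 : 'M[K]_n) (a : K) :=
  E0 + a *: E1 + a^-1 *: E2.

Section ThreeWeights.
Variables (K : closedFieldType) (n : nat) (E0 E1 E2 : 'M[K]_(2 * n)).
Hypothesis sum1 : E0 + E1 + E2 = 1%:M.
Hypotheses (E01 : E0 *m E1 = 0) (E02 : E0 *m E2 = 0) (E10 : E1 *m E0 = 0).
Hypotheses (E12 : E1 *m E2 = 0) (E20 : E2 *m E0 = 0) (E21 : E2 *m E1 = 0).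
Hypotheses (dual0 : E0^T *m OmegaS K n = OmegaS K n *m E0)
           (dual1 : E1^T *m OmegaS K n = OmegaS K n *m E2)
           (dual2 : E2^T *m OmegaS K n = OmegaS K n *m E1).

Let lam := three_weight E0 E1 E2.

Let E00 : E0 *m E0 = E0.
Proof. by rewrite -[RHS]mulmx1 -sum1 !mulmxDr E01 E02 !addr0. Qed.

Let E11 : E1 *m E1 = E1.
Proof. by rewrite -[RHS]mulmx1 -sum1 !mulmxDr E10 E12 addr0 add0r. Qed.

Let E22 : E2 *m E2 = E2.
Proof. by rewrite -[RHS]mulmx1 -sum1 !mulmxDr E20 E21 !add0r. Qed.

Let E0lam a : E0 *m lam a = E0.
Proof. by rewrite /lam /three_weight !mulmxDr -!scalemxAr E00 E01 E02 !scaler0 !addr0. Qed.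

Let E1lam a : E1 *m lam a = a *: E1.
Proof. by rewrite /lam /three_weight !mulmxDr -!scalemxAr E10 E11 E12 !scaler0 addr0 add0r. Qed.

Let E2lam a : E2 *m lam a = a^-1 *: E2.
Proof. by rewrite /lam /three_weight !mulmxDr -!scalemxAr E20 E21 E22 !scaler0 !add0r. Qed.

Let lamM a b : lam (a * b) = lam a *m lam b.
Proof.
rewrite [lam a]/three_weight !mulmxDl -!scalemxAl E0lam E1lam E2lam !scalerA.
by rewrite -invfM.
Qed.

Let lamV a : a != 0 -> lam a *m lam a^-1 = 1%:M.
Proof. by move=> a0; rewrite -lamM mulfV // /lam /three_weight invr1 !scale1r. Qed.

Let lamSp a : a != 0 -> lam a \in Sp K n.
Proof.
move=> a0; rewrite !inE; have [-> _] := mulmx1_unit (lamV a0); rewrite /=.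
have lamT : (lam a)^T *m OmegaS K n = OmegaS K n *m lam a^-1.
  rewrite /lam /three_weight !linearD !linearZ /= !mulmxDl -!scalemxAl.
  by rewrite dual0 dual1 dual2 invrK addrAC.
rewrite lamT -mulmxA -[X in _ *m (_ *m lam X)]invrK lamV ?invr_eq0 //.
by rewrite mulmx1.
Qed.

Lemma three_weight_cocharacter : cocharacter lam.
Proof.
split=> [||i j]; [exact: lamSp | by move=> a b _ _; exact: lamM |].
exists ((E0 i j)%:P * 'X + (E1 i j)%:P * 'X^2 + (E2 i j)%:P), 1%N => a a0.
by rewrite !mxE !(hornerD, hornerM, hornerC, hornerX, hornerXn); field.
Qed.

Lemma three_weight_limit x :
  E0 *m x *m E1 = 0 -> E2 *m x *m E0 = 0 -> E2 *m x *m E1 = 0 ->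
  is_limit lam x (E0 *m x *m E0 + E1 *m x *m E1 + E2 *m x *m E2).
Proof.
move=> x01 x20 x21.
pose y0 := E0 *m x *m E0 + E1 *m x *m E1 + E2 *m x *m E2.
(* [y0], [y1], [y2] collect the blocks of weights 0, 1, 2; the hypotheses kill those of weights -1
   and -2. *)
pose y1 := E1 *m x *m E0 + E0 *m x *m E2.
pose y2 := E1 *m x *m E2.
exists (fun a => y0 + a *: y1 + a ^+ 2 *: y2); split=> [i j|a a0|].
- exists ((y0 i j)%:P + (y1 i j)%:P * 'X + (y2 i j)%:P * 'X^2) => a.
  rewrite !(hornerD, hornerM, hornerC, hornerX, hornerXn).
  by move: y0 y1 y2 => z0 z1 z2; rewrite !mxE; ring.
- have [ulam _] := mulmx1_unit (lamV a0).
  rewrite /Ad -[LHS](mulmxK ulam); congr (_ *m _).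
  have xE M : M *m x = M *m x *m E0 + M *m x *m E1 + M *m x *m E2.
    by rewrite -!mulmxDr sum1 mulmx1.
  have r0 M : M *m E0 *m lam a = M *m E0 by rewrite -mulmxA E0lam.
  have r1 M : M *m E1 *m lam a = a *: (M *m E1).
    by rewrite -mulmxA E1lam scalemxAr.
  have r2 M : M *m E2 *m lam a = a^-1 *: (M *m E2).
    by rewrite -mulmxA E2lam scalemxAr.
  rewrite /y0 /y1 /y2 !mulmxDl -!scalemxAl !mulmxDl !r0 !r1 !r2.
  rewrite [E0 *m x in RHS]xE [E1 *m x in RHS]xE [E2 *m x in RHS]xE x01 x20 x21 !addr0 !add0r.
  rewrite !scalerDr !scalerA expr2 mulfK // mulfV // scale1r !addrA.
  by rewrite [RHS](ACl (1*4*6*3*2*5)).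
by rewrite expr0n !scale0r !addr0.
Qed.

End ThreeWeights.

(** * Computation with integer matrices *)

Definition tab (f : nat -> nat -> int) : seq (seq int) :=
  mkseq (fun i => mkseq (f i) 8) 8.

Definition ent (s : seq (seq int)) i j : int := nth 0 (nth [::] s i) j.

(** Identities over the integers, decided by [vm_compute], transfer to every [K] at once. *)
Definition intmx (K : closedFieldType) (s : seq (seq int)) : 'M[K]_(2 * 4) :=
  \matrix_(i, j) (ent s i j)%:~R.

Lemma entE f (i j : 'I_(2 * 4)) : ent (tab f) i j = f i j.
Proof. by rewrite /ent !nth_mkseq. Qed.

Lemma intmx_eq (K : closedFieldType) s t : s == t -> intmx K s = intmx K t.
Proof. by move=> /eqP->. Qed.

(* Named operations, so that vm_compute evaluates each operand only once. *)
Definition add8 s t := tab (fun i j => ent s i j + ent t i j).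
Definition tr8 s := tab (fun i j => ent s j i).
Definition scale8 c s := tab (fun i j => c * ent s i j).
Definition mul8 s t :=
  tab (fun i j => foldr (fun k c => ent s i k * ent t k j + c) 0 (iota 0 8)).

Lemma intmxD (K : closedFieldType) s t :
  intmx K s + intmx K t = intmx K (add8 s t).
Proof. by apply/matrixP=> i j; rewrite !mxE entE rmorphD. Qed.

Lemma intmxM (K : closedFieldType) s t :
  intmx K s *m intmx K t = intmx K (mul8 s t).
Proof.
apply/matrixP=> i j; rewrite !mxE entE.
have -> : foldr (fun k c => ent s i k * ent t k j + c) 0 (iota 0 8)
          = \sum_(k < 8) ent s i k * ent t k j.
  by rewrite -(big_mkord xpredT (fun k => ent s i k * ent t k j)) unlock.
by rewrite rmorph_sum; apply: eq_bigr => k _; rewrite !mxE rmorphM.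
Qed.

Lemma intmxT (K : closedFieldType) s : (intmx K s)^T = intmx K (tr8 s).
Proof. by apply/matrixP=> i j; rewrite !mxE entE. Qed.

Lemma intmxZ (K : closedFieldType) (c : int) s :
  c%:~R *: intmx K s = intmx K (scale8 c s).
Proof. by apply/matrixP=> i j; rewrite !mxE entE rmorphM. Qed.

Lemma intmx0 (K : closedFieldType) : 0 = intmx K (tab (fun _ _ => 0)).
Proof. by apply/matrixP=> i j; rewrite !mxE entE. Qed.

Lemma intmx_pid (K : closedFieldType) r :
  pid_mx r = intmx K (tab (fun i j => ((i == j) && (i < r)%N)%:R)).
Proof. by apply/matrixP=> i j; rewrite !mxE entE rmorph_nat. Qed.

Lemma intmx1 (K : closedFieldType) :
  1%:M = intmx K (tab (fun i j => (i == j)%:R)).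
Proof. by apply/matrixP=> i j; rewrite !mxE entE rmorph_nat. Qed.

Lemma intmx_Omega (K : closedFieldType) :
  OmegaS K 4 = intmx K (tab (fun i j =>
    if i == (7 - j)%N then if (j < 4)%N then -1 else 1 else 0)).
Proof.
apply/matrixP=> i j; rewrite !mxE entE -(inj_eq val_inj) /= subSS.
by case: ifP => // _; case: ifP; rewrite ?rmorphN rmorph1.
Qed.

Definition intmxE :=
  (intmxT, intmx_Omega, intmx1, intmx0, intmx_pid, intmxM, intmxD, intmxZ).

(** * Orbit representatives and their ranks *)

Definition cell (i j : nat) (c : int) := (i, j, c).

Definition sparse (l : seq (nat * nat * int)) : seq (seq int) :=
  tab (fun i j => foldr (fun t c => if t.1 == (i, j) then t.2 else c) 0 l).

(* The columns of these matrices are the images of the basis e_0, ..., e_7, on *)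
(* which the form takes the values <e_i, e_(7-i)> = 1 for i < 4.              *)
Definition nil8 := sparse
  [:: cell 0 1 1; cell 1 2 1; cell 2 3 1; cell 3 4 1;
      cell 4 5 (-1); cell 5 6 (-1); cell 6 7 (-1)].

Definition nil44 := sparse
  [:: cell 0 1 1; cell 1 2 1; cell 2 3 1;
      cell 4 5 (-1); cell 5 6 (-1); cell 6 7 (-1)].

(* e_3 -> e_2 + e_6 -> e_1 - e_5 -> 2 e_4 -> 0 and e_2 - e_6 -> e_1 + e_5 -> 0 *)
Definition nil4211 := sparse
  [:: cell 4 1 1; cell 1 2 1; cell 2 3 1; cell 6 3 1; cell 4 5 (-1);
      cell 5 6 (-1)].

Lemma nil8_sp (K : closedFieldType) : intmx K nil8 \in sp K 4.
Proof. by rewrite inE !intmxE; apply/eqP/intmx_eq; vm_compute. Qed.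

Lemma nil44_sp (K : closedFieldType) : intmx K nil44 \in sp K 4.
Proof. by rewrite inE !intmxE; apply/eqP/intmx_eq; vm_compute. Qed.

Lemma nil4211_sp (K : closedFieldType) : intmx K nil4211 \in sp K 4.
Proof. by rewrite inE !intmxE; apply/eqP/intmx_eq; vm_compute. Qed.

Lemma nil8_nilpotent (K : closedFieldType) : intmx K nil8 ^+ 8 = 0.
Proof. by rewrite !exprS expr0 -idmxE -!mulmxE !intmxE; apply: intmx_eq; vm_compute. Qed.

Lemma nil44_nilpotent (K : closedFieldType) : intmx K nil44 ^+ 4 = 0.
Proof. by rewrite !exprS expr0 -idmxE -!mulmxE !intmxE; apply: intmx_eq; vm_compute. Qed.

Lemma nil4211_nilpotent (K : closedFieldType) : intmx K nil4211 ^+ 4 = 0.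
Proof. by rewrite !exprS expr0 -idmxE -!mulmxE !intmxE; apply: intmx_eq; vm_compute. Qed.

Lemma rank_nil8 (K : closedFieldType) : \rank (intmx K nil8) = 7%N.
Proof.
pose L := sparse [:: cell 0 0 1; cell 1 1 1; cell 2 2 1; cell 3 3 1;
                     cell 4 4 (-1); cell 5 5 (-1); cell 6 6 (-1)].
pose R := sparse [:: cell 0 1 1; cell 1 2 1; cell 2 3 1; cell 3 4 1;
                     cell 4 5 1; cell 5 6 1; cell 6 7 1].
pose P := sparse [:: cell 1 0 1; cell 2 1 1; cell 3 2 1; cell 4 3 1;
                     cell 5 4 1; cell 6 5 1; cell 7 6 1].
apply: (@mxrank_pid_factor _ _ _ (intmx K L) (intmx K R) (intmx K L) (intmx K P) 1%:~R).
- by [].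
- exact: oner_neq0.
- by rewrite !intmxE; apply: intmx_eq; vm_compute.
- by rewrite !intmxE; apply: intmx_eq; vm_compute.
Qed.

Lemma rank_nil4211 (K : closedFieldType) : \rank (intmx K nil4211) = 4%N.
Proof.
pose L := sparse [:: cell 4 0 1; cell 1 1 1; cell 2 2 1; cell 6 2 1; cell 5 3 1].
pose R := sparse [:: cell 0 1 1; cell 0 5 (-1); cell 1 2 1; cell 2 3 1;
                     cell 3 6 (-1)].
(* [M] selects rows 4, 1, 2, 5 and [P], up to sign, columns 1, 2, 3, 6, where [nil4211] is diagonal
   with entries 1, 1, 1, -1. *)
pose M := sparse [:: cell 0 4 1; cell 1 1 1; cell 2 2 1; cell 3 5 1].
pose P := sparse [:: cell 1 0 1; cell 2 1 1; cell 3 2 1; cell 6 3 (-1)].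
apply: (@mxrank_pid_factor _ _ _ (intmx K L) (intmx K R) (intmx K M) (intmx K P) 1%:~R).
- by [].
- exact: oner_neq0.
- by rewrite !intmxE; apply: intmx_eq; vm_compute.
- by rewrite !intmxE; apply: intmx_eq; vm_compute.
Qed.

(** Only e_3 survives three steps, ending at 2 e_4, which is nonzero because the characteristic is
    not 2. *)
Lemma rank_nil4211_cube (K : closedFieldType) :
  2%N \notin [pchar K] -> \rank (intmx K nil4211 ^+ 3) = 1%N.
Proof.
move=> charK.
pose L := sparse [:: cell 4 0 2].
pose R := sparse [:: cell 0 3 1].
pose M := sparse [:: cell 0 4 1].
pose P := sparse [:: cell 3 0 1].
apply: (@mxrank_pid_factor _ _ _ (intmx K L) (intmx K R) (intmx K M) (intmx K P) 2%:~R).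
- by [].
- by move: charK; rewrite inE.
- by rewrite !exprS expr0 -idmxE -!mulmxE !intmxE; apply: intmx_eq; vm_compute.
- by rewrite !exprS expr0 -idmxE -!mulmxE !intmxE; apply: intmx_eq; vm_compute.
Qed.

(** * The two degenerations and the conclusion *)

(** Weights 1 and -1 sit on the isotropic halves e_0, ..., e_3 and e_4, ..., e_7. The one entry of
    [nil8] joining them, e_4 -> e_3, has weight 2 and dies. *)
Lemma limit_nil8_nil44 (K : closedFieldType) :
  exists2 lam, cocharacter lam & is_limit lam (intmx K nil8) (intmx K nil44).
Proof.
pose E0 := sparse [::].
pose E1 := sparse [:: cell 0 0 1; cell 1 1 1; cell 2 2 1; cell 3 3 1].
pose E2 := sparse [:: cell 4 4 1; cell 5 5 1; cell 6 6 1; cell 7 7 1].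
exists (three_weight (intmx K E0) (intmx K E1) (intmx K E2)).
  by apply: three_weight_cocharacter; rewrite !intmxE; apply: intmx_eq; vm_compute.
have -> : intmx K nil44 = intmx K E0 *m intmx K nil8 *m intmx K E0
    + intmx K E1 *m intmx K nil8 *m intmx K E1
    + intmx K E2 *m intmx K nil8 *m intmx K E2.
  by rewrite !intmxE; apply: intmx_eq; vm_compute.
by apply: three_weight_limit; rewrite !intmxE; apply: intmx_eq; vm_compute.
Qed.

(* The span of v = e_3 + e_7 and its images is a single Jordan block, on which *)
(* the form is nondegenerate since <v, nil44^3 v> = -2. Weight 1 is carried by *)
(* p = nil44^3 v = e_0 - e_4 and weight -1 by e_7, so the limit acts on        *)
(* p^perp / p, where this block has shrunk from size 4 to size 2.              *)
Lemma limit_nil44_nil4211 (K : closedFieldType) :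
  exists2 lam, cocharacter lam & is_limit lam (intmx K nil44) (intmx K nil4211).
Proof.
(* Weight 0 lives on the orthogonal of p and e_7, spanned by e_1, e_2, e_4, e_5, e_6 and e_3 -
   e_7. *)
pose E0 := sparse [:: cell 4 0 1; cell 1 1 1; cell 2 2 1; cell 3 3 1;
                      cell 7 3 (-1); cell 4 4 1; cell 5 5 1; cell 6 6 1].
pose E1 := sparse [:: cell 0 0 1; cell 4 0 (-1)].
pose E2 := sparse [:: cell 7 7 1; cell 7 3 1].
exists (three_weight (intmx K E0) (intmx K E1) (intmx K E2)).
  by apply: three_weight_cocharacter; rewrite !intmxE; apply: intmx_eq; vm_compute.
have -> : intmx K nil4211 = intmx K E0 *m intmx K nil44 *m intmx K E0
    + intmx K E1 *m intmx K nil44 *m intmx K E1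
    + intmx K E2 *m intmx K nil44 *m intmx K E2.
  by rewrite !intmxE; apply: intmx_eq; vm_compute.
by apply: three_weight_limit; rewrite !intmxE; apply: intmx_eq; vm_compute.
Qed.

Lemma Sp_orbit_accessible (K : closedFieldType) n (x y : 'M[K]_(2 * n)) :
  (exists2 lam, cocharacter lam & is_limit lam x y) ->
  one_accessible (Sp_orbit x) (Sp_orbit y).
Proof. by case=> lam coch lim; exists lam, x, y; split=> //; exact: Sp_orbit_refl. Qed.

Theorem lemma4p4 (K : closedFieldType) (charK : 2%N \notin [pchar K]) :
  exists (n : nat) (O1 O2 O3 : 'M[K]_(2 * n) -> Prop),
    (1 <= n)%N /\
    [/\ nilpotent_orbit O1, nilpotent_orbit O2 & nilpotent_orbit O3] /\
    [/\ one_accessible O1 O2, one_accessible O2 O3 & ~ one_accessible O1 O3].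
Proof.
exists 4%N, (Sp_orbit (intmx K nil8)), (Sp_orbit (intmx K nil44)),
  (Sp_orbit (intmx K nil4211)).
split=> //; split; split.
- exists (intmx K nil8); split=> //; first exact: nil8_sp.
  by exists 8%N; exact: nil8_nilpotent.
- exists (intmx K nil44); split=> //; first exact: nil44_sp.
  by exists 4%N; exact: nil44_nilpotent.
- exists (intmx K nil4211); split=> //; first exact: nil4211_sp.
  by exists 4%N; exact: nil4211_nilpotent.
- exact/Sp_orbit_accessible/limit_nil8_nil44.
- exact/Sp_orbit_accessible/limit_nil44_nil4211.
move=> [lam [x [y [coch [g gSp xE] lim [h hSp yE]]]]].
move: lim; rewrite xE yE => lim.
have [ug uh] := (Sp_unit gSp, Sp_unit hSp).
(* This rank is 1, whichever representative of the orbit the limit is. *)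
suff: ~~ odd (\rank (Ad h (intmx K nil4211) ^+ 3)).
  by rewrite exprmx_Ad // mxrank_Ad // rank_nil4211_cube.
apply: (odd_rank_limit _ coch lim).
- by rewrite mxrank_Ad // rank_nil8.
- exact/Ad_sp/nil4211_sp.
- by exists 4%N; rewrite exprmx_Ad // nil4211_nilpotent /Ad mulmx0 mul0mx.
- by rewrite mxrank_Ad // rank_nil4211.
Qed.
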